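(* Let $p > 7$ be a prime and let $G(\circ)$ be a group of order $p$ with underlying set $G$. Then the Cayley stability of $G(\circ)$ equals $6p-18$, i.e. $\delta(G(\circ)) = 6p-18$.
   Context: For a finite set $G$ and two group operations $\circ$, $\ast$ on $G$ (giving groups $G(\circ)$, $G(\ast)$ with the same underlying set $G$), the (Hamming) distance $dist(G(\circ),G(\ast))$ is the number of pairs $(a,b)\in G\times G$ with $a\circ b\neq a\ast b$. The Cayley stability of $G(\circ)$ is $\delta(G(\circ))=\min\{dist(G(\circ),G(\ast)) : G(\ast)\neq G(\circ)\}$, where the minimum is over all groups $G(\ast)$ defined on the same set $G$ whose operation $\ast$ is different from $\circ$ (whether or not $G(\ast)$ is isomorphic to $G(\circ)$). *)

(* Defs.v *)
From mathcomp Require Import all_boot.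

Set Implicit Arguments.
Unset Strict Implicit.
Unset Printing Implicit Defensive.

Lemma bigminn_le (I : finType) (P : pred I) (f : I -> nat) k (j : I) :
  P j -> \big[minn/k]_(i | P i) f i <= f j.
Proof.
move=> Pj; have := mem_index_enum j.
elim: (index_enum I) => //= i r IH; rewrite in_cons big_cons.
case/predU1P=> [<-|/IH le_j]; first by rewrite Pj geq_minl.
by case: ifP => // _; rewrite geq_min le_j orbT.
Qed.

Section GroupLaws.

Variable G : finType.
Implicit Types op : G -> G -> G.

Definition group_law op : bool :=
  [forall x, forall y, forall z, op x (op y z) == op (op x y) z] &&
  [exists e, [forall x, (op e x == x) && (op x e == x)] &&
             [forall x, exists y, (op y x == e) && (op x y == e)]].

Lemma group_lawP op :
  reflect
    (associative op /\
     exists e (inv : G -> G),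
       [/\ left_id e op, right_id e op,
           left_inverse e inv op & right_inverse e inv op])
    (group_law op).
Proof.
apply: (iffP andP) => [[/forallP opA /existsP[e /andP[/forallP e1 /forallP eV]]]|].
  split; first by move=> x y z; exact/eqP/(forallP (forallP (opA x) y)).
  have ex x : exists y, (op y x == e) && (op x y == e) by exact/existsP.
  exists e, (fun x => xchoose (ex x)); split=> x.
  - by case/andP: (e1 x) => /eqP.
  - by case/andP: (e1 x) => _ /eqP.
  - by case/andP: (xchooseP (ex x)) => /eqP.
  - by case/andP: (xchooseP (ex x)) => _ /eqP.
move=> [opA [e [inv [e1l e1r eVl eVr]]]]; split.
  by apply/forallP=> x; apply/forallP=> y; apply/forallP=> z; rewrite opA.
apply/existsP; exists e; apply/andP; split; apply/forallP=> x.
  by rewrite e1l e1r !eqxx.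
by apply/existsP; exists (inv x); rewrite eVl eVr !eqxx.
Qed.

Definition cayley_dist (op1 op2 : G -> G -> G) : nat :=
  #|[set ab : G * G | op1 ab.1 ab.2 != op2 ab.1 ab.2]|.

(* The minimum ranges over the finite type of binary operations on G, encoded *)
(* as finite functions on pairs.  Every distance is at most #|G| ^ 2, so this *)
(* default value of the big operator only matters when op is the sole group   *)
(* law on G; see cayley_stabilityP.                                           *)
Definition cayley_stability op : nat :=
  \big[minn/#|G| ^ 2]_(ast : {ffun G * G -> G} |
       group_law (fun a b => ast (a, b)) && (ast != [ffun ab => op ab.1 ab.2]))
    cayley_dist op (fun a b => ast (a, b)).

Lemma cayley_dist_le op1 op2 : cayley_dist op1 op2 <= #|G| ^ 2.
Proof. by rewrite -mulnn -card_prod max_card. Qed.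

Lemma cayley_stabilityP op d :
  (exists2 ast : G -> G -> G, group_law ast & ~ ast =2 op) ->
  cayley_stability op = d <->
  (exists ast : G -> G -> G,
     [/\ group_law ast, ~ ast =2 op & cayley_dist op ast = d]) /\
  (forall ast : G -> G -> G,
     group_law ast -> ~ ast =2 op -> d <= cayley_dist op ast).
Proof.
move=> exG.
have glE (f g : G -> G -> G) : f =2 g -> group_law f = group_law g.
  move=> fg; rewrite /group_law; congr andb.
    by do 3 (apply: eq_forallb => ?); rewrite !fg.
  apply: eq_existsb => e; congr andb; apply: eq_forallb => x.
    by rewrite !fg.
  by apply: eq_existsb => y; rewrite !fg.
have dE (f g : G -> G -> G) : f =2 g -> cayley_dist op f = cayley_dist op g.
  by move=> fg; apply: eq_card => ab; rewrite !inE fg.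
have lb (ast : G -> G -> G) : group_law ast -> ~ ast =2 op ->
    cayley_stability op <= cayley_dist op ast.
  move=> gA nA; pose F := [ffun ab : G * G => ast ab.1 ab.2].
  have FE : (fun a b => F (a, b)) =2 ast by move=> a b; rewrite ffunE.
  rewrite -(dE _ _ FE) /cayley_stability; apply: bigminn_le.
  rewrite (glE _ _ FE) gA; apply/eqP => /ffunP FO; apply: nA => a b.
  by move: (FO (a, b)); rewrite !ffunE.
have at_ : exists ast : G -> G -> G,
    [/\ group_law ast, ~ ast =2 op & cayley_dist op ast = cayley_stability op].
  have [E|//] : cayley_stability op = #|G| ^ 2 \/ exists ast : G -> G -> G,
      [/\ group_law ast, ~ ast =2 op & cayley_dist op ast = cayley_stability op].
    rewrite /cayley_stability; elim/big_ind: _ => [|m n [->|Hm] [->|Hn]|F].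
    - by left.
    - by left; rewrite minnn.
    - by rewrite /minn; case: ifP => _; [left | right].
    - by rewrite /minn; case: ifP => _; [right | left].
    - by rewrite /minn; case: ifP => _; right.
    - case/andP=> gF nF; right; exists (fun a b => F (a, b)); split=> // FO.
      by case/eqP: nF; apply/ffunP => -[a b]; rewrite ffunE FO.
  case: exG => ast gA nA; exists ast; split=> //; apply/eqP.
  by rewrite eqn_leq lb // E cayley_dist_le.
split=> [<- //|[[ast [gA nA <-]] min]]; apply/eqP.
rewrite eqn_leq lb //=; case: at_ => a [ga na <-]; exact: min.
Qed.

End GroupLaws.

(* Main.v *)
Require Import Defs.
From HB Require Import structures.
From mathcomp Require Import all_boot.
From mathcomp Require Import all_algebra all_fingroup all_solvable zify ring.

(** Fix a prime p > 7.  Every group law on a set of p elements is the addition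
    of 'F_p read through a bijection, so two laws are compared by a bijection
    f of 'F_p, and their distance is the number of pairs (a, b) with
    f (a + b) <> f a + f b.  Call such a pair bad and let d a be the number of
    bad pairs in row a.  The swap of 1 and -1 has exactly 6p - 18 bad pairs, so
    the point is that an injective f that is not additive has at least that
    many.

    If all nonzero rows have at least six bad pairs, this is clear.  Otherwise
    pick a nonzero row with the smallest number m < 6 of bad pairs; rescaling
    source and target makes it row 1 and gives f 1 = 1.  Write f x = x + s x.  The function
    s is constant along x, x + 1, x + 2, ... except at m places, so it has few
    values and some level set of s has at least p / m elements.  Four facts
    then bound the number of bad pairs from below.
    - A row a <> 0 with s a = 0 contains an exit from every level set of s, and
      s has at least three values because its values sum to 0; hence m >= 3
      (image_le_row, image_ge3).
    - In a row a with s a <> 0, walk from any point of a level set in steps of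
      a: as long as no bad pair is met, s grows by s a at each step, which
      cannot last.  The first bad pair determines the starting point, so
      d a is at least the size of every level set (level_le_row).
    - If (a, b) is bad then d a + d b + d (a + b) >= p, because otherwise some c
      makes every pair involved in the associativity of a + b + c good
      (assoc_rows).
    - If s vanishes outside a set of j points, then all but j of the
      nonzero rows in which s vanishes have at least four bad pairs (defect_near_line).
    The third fact settles m = 5 for p >= 17; the second and the fourth settle
    m = 3 for p >= 19 and m = 4 for p >= 23 (counting_ge).  In the nine cases
    that are left, f is an exchange of at most five cyclic intervals, and all
    such exchanges are enumerated by a verified computation
    (small_cases_certified, certified_sound). *)

Set Implicit Arguments.
Unset Strict Implicit.
Unset Printing Implicit Defensive.

Import GRing.Theory.

(** * Exhaustive search over interval exchanges *)

Section Search.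
Variable p : nat.

(** Residues mod p are represented by naturals below p, so the sum of two of
    them equals a third one mod p exactly when it exceeds it by 0 or p.  The
    comparison eqn is used because it reduces without unfolding any
    structure. *)
Fixpoint row_errors c (l r : seq nat) : nat :=
  match l, r with
  | x :: l', y :: r' =>
    if eqn (x + c) y then row_errors c l' r'
    else if eqn (x + c) (y + p) then row_errors c l' r'
    else (row_errors c l' r').+1
  | _, _ => 0
  end.

(** The lists l and cs hold the values of f, and r holds the same values
    starting from the row that is read; the scan stops once the errors reach
    the number that is asked for. *)
Fixpoint errors_reach need (l cs r : seq nat) : bool :=
  match need, cs, r with
  | 0, _, _ => true
  | _, c :: cs', _ :: r' => errors_reach (need - row_errors c l r) l cs' r'
  | _, _, _ => false
  end.

Definition far l := errors_reach (6 * p - 18) l l (l ++ l).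

Definition next x := if eqn x.+1 p then 0 else x.+1.

(** The list l holds f t, ..., f 1, and n values are still to be chosen.  A value
    y is in K when f does not continue with y + 1 after y.  As f is injective,
    it must then continue with the successor of another member of K: this keeps
    the branching low. *)
Fixpoint search (K : seq nat) n (l : seq nat) : bool :=
  match n, l with
  | n'.+1, y :: _ =>
    if has (eqn y) K then
      all (fun z => if eqn z (next y) then true
                    else if has (eqn z) l then true
                    else search K n' (z :: l)) (map next K)
    else search K n' (next y :: l)
  | _, y :: l' => far (y :: rev l')
  | _, [::] => false
  end.

Fixpoint sublists m (s : seq nat) : seq (seq nat) :=
  match m, s with
  | 0, _ => [:: [::]]
  | m'.+1, x :: s' => [seq x :: t | t <- sublists m' s'] ++ sublists m s'
  | _, _ => [::]
  end.

Definition certified m :=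
  all (fun K => search K p.-1 [:: 1]) (sublists m (iota 0 p)).

Lemma mem_sublists s K : subseq K s -> K \in sublists (size K) s.
Proof.
elim: s K => [|x s IHs] [|y K] //=; rewrite mem_cat.
case: eqP => [-> | _] sK; last by rewrite (IHs (y :: K)) ?orbT.
by rewrite (map_f (cons x)) // IHs.
Qed.

End Search.

(** The pairs (p, m) that escape the estimates: p is the prime, and m the
    smallest number of bad pairs in a nonzero row. *)
Definition small_cases : seq (nat * nat) :=
  [:: (11, 3); (11, 4); (11, 5); (13, 3); (13, 4); (13, 5);
      (17, 3); (17, 4); (19, 4)]%N.

Lemma small_cases_certified : all (fun c => certified c.1 c.2) small_cases.
Proof. by vm_compute. Qed.

(** * An optimization over the naturals *)

(** With k, M and j the sizes of the zero level, of a largest level and of the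
    complement of the zero level, the two hypotheses on t are the lower bounds
    of defect_ge_level and defect_near_line.  The first one is concave in M and
    is enough up to M = n - 4; beyond, either the zero level is the largest one
    and j is 2 or 3, or the zero level has at most three elements. *)
Lemma counting_ge (n m M k j t : nat) :
  (m = 3 /\ 18 < n \/ m = 4 /\ 22 < n)%N -> (n <= m * M)%N -> (k <= M)%N ->
  (k = M \/ k + M <= n)%N -> (k + j = n)%N -> (1 < j)%N ->
  (m * k.-1 + M * (n - k) <= t)%N -> (4 * k.-1 + j * k <= t + j)%N ->
  (6 * n - 18 <= t)%N.
Proof.
move=> mn nmM kM kM_or kj j2 B near.
have M6 : (5 < M)%N by case: mn nmM => -[-> ?]; lia.
have jE : (n - k = j)%N by lia.
rewrite {}jE in B; have {kj} nE : n = (k + j)%N by lia.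
subst n.
have [Msmall|Mbig] := leqP (M + 4) (k + j).
  have [e [r [Me je]]] : exists e r, M = (k + e)%N /\ j = (e + 4 + r)%N.
    by exists (M - k)%N, (k + j - M - 4)%N; lia.
  have eM : (m * e <= M * e)%N by rewrite leq_mul2r; lia.
  have r6 : (6 * r <= M * r)%N by rewrite leq_mul2r; lia.
  have : (m * k.-1 + (M * e + M * 4 + M * r) <= t)%N by rewrite -!mulnDr -je.
  (* For m = 3 the size M can be 7 or 8; then r is large, as n >= 19. *)
  have : (m = 3 /\ 7 <= M /\ (M <= 8 -> 7 <= r) /\ (7 * r <= M * r) \/ m = 4)%N.
    case: mn nmM => -[-> ?] ?; [left | by right]; have M7 : (7 <= M)%N by lia.
    by rewrite leq_mul2r M7 orbT; lia.
  move: eM r6; move: (M * e)%N (M * r)%N => P Q eM r6 mE Bt.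
  by case: mE eM Bt => [[-> [? [? ?]]] | ->]; lia.
case: kM_or => [kE|kMn]; last first.
  (* Here k <= 3, so that j >= 16, and n <= M + 3. *)
  have : (M * 8 <= M * j)%N by rewrite leq_mul2l; lia.
  by lia.
have [jj|jj] : (j = 2 \/ j = 3)%N by lia.
  by rewrite jj in near *; lia.
by rewrite jj in near *; lia.
Qed.

(** * Bad pairs of a map of 'F_p *)

Local Open Scope ring_scope.

Section Defect.
Variable p : nat.
Hypothesis p_pr : prime p.
Local Notation F := 'F_p.
Implicit Types (f : F -> F) (a b c w x y : F) (A : {set F}).

Definition row_defect f a : nat := #|[set b | f (a + b) != f a + f b]|.
Definition defect f : nat := (\sum_a row_defect f a)%N.

Definition disp f x : F := f x - x.
Definition level f w : {set F} := [set x | disp f x == w].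

Lemma natr_Fp x : (nat_of_ord x)%:R = x.
Proof. exact: natr_Zp. Qed.

Lemma card_compl A : (#|A| + #|~: A| = p)%N.
Proof. by rewrite cardsC card_Fp. Qed.

Lemma card_pred0 A : (#|A|.-1 <= #|A :\ 0%R|)%N.
Proof. by rewrite (cardsD1 0 A); case: (0 \in A); rewrite ?leq_pred. Qed.

Lemma card_compl0 A : (p.-1 <= #|A| + #|~: A :\ 0%R|)%N.
Proof. by have := card_compl A; have := card_pred0 (~: A); lia. Qed.

(** Translation by a nonzero element is a single cycle on 'F_p, so it preserves
    no proper nonempty subset. *)
Lemma exit_exists A a : a != 0 -> A != set0 -> A != setT ->
  exists2 x, x \in A & a + x \notin A.
Proof.
move=> a0 /set0Pn[x0 Ax0] AT.
case: (pickP [pred x | (x \in A) && (a + x \notin A)]) => [x /= /andP[]|stay].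
  by exists x.
have walk n : x0 + a *+ n \in A.
  elim: n => [|n IHn]; first by rewrite addr0.
  by move: (stay (x0 + a *+ n)); rewrite /= IHn mulrS addrCA => /negbFE.
case/eqP: AT; apply/setP=> y; rewrite inE.
have := walk ((y - x0) / a); rewrite -mulr_natr natr_Fp mulrC divfK //.
by rewrite addrC subrK.
Qed.

Lemma goodE f a b :
  (f (a + b) == f a + f b) = (disp f (a + b) == disp f a + disp f b).
Proof. by rewrite /disp addrACA -opprD (inj_eq (addIr _)). Qed.

Lemma row_defectE f a :
  row_defect f a = #|[set b | disp f (a + b) != disp f a + disp f b]|.
Proof. by congr #|pred_of_set _|; apply/setP=> b; rewrite !inE goodE. Qed.

(** Each x in the level set is sent to the first point x + a *+ n whose
    pair with a is bad.  Along the way disp f grows by disp f a at each step, so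
    the displacement at that point determines n, hence x.  The value y is what
    prevents the walk from going on for ever: its displacements would then run
    through all of 'F_p. *)
Lemma level_le_row f a w y : (forall x, disp f x != y) -> disp f a != 0 ->
  (#|level f w| <= row_defect f a)%N.
Proof.
move=> missed sa0; rewrite row_defectE; set B := [set b | _].
have stop x : exists n, x + a *+ n \in B.
  case: (pickP [pred i : F | x + a *+ i \in B]) => [i /= Bi | run].
    by exists (i : nat).
  have climb n : disp f (x + a *+ n) = disp f x + disp f a *+ n.
    elim: n => [|n IHn]; first by rewrite !addr0.
    have := run (n%:R); rewrite /= inE => /negbFE; rewrite -[a *+ _]mulr_natr natr_Fp mulr_natr.
    by move=> /eqP; rewrite addrCA -mulrS IHn addrCA -mulrS.
  have /eqP[] := missed (x + a *+ ((y - disp f x) / disp f a)).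
  by rewrite climb -mulr_natr natr_Fp [disp f a * _]mulrC divfK // addrC subrK.
pose len x := ex_minn (stop x).
have lenB x : x + a *+ len x \in B by rewrite /len; case: ex_minnP.
have climb x n : (n <= len x)%N -> disp f (x + a *+ n) = disp f x + disp f a *+ n.
  rewrite /len; case: ex_minnP => l _ l_min.
  elim: n => [|n IHn] ltnl; first by rewrite !addr0.
  have /contraNN/(_ _) := l_min n; rewrite -ltnNge => /(_ ltnl).
  rewrite inE negbK => /eqP; rewrite addrCA -mulrS IHn 1?ltnW //.
  by rewrite addrCA -mulrS.
have landI : {in level f w &, injective (fun x => x + a *+ len x)}.
  move=> x x'; rewrite !inE => /eqP sx /eqP sx' eqxx'.
  have := climb _ _ (leqnn (len x)); rewrite eqxx' climb // sx sx' => /addrI.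
  rewrite -[_ *+ len x]mulr_natr -[_ *+ len x']mulr_natr => /(mulfI sa0) eqlen.
  move: eqxx'; rewrite -[a *+ len x]mulr_natr -[a *+ len x']mulr_natr eqlen.
  by move/addIr.
by rewrite -(card_in_imset landI) subset_leq_card //; apply/subsetP=> _ /imsetP[x _ ->].
Qed.

(** When disp f a = 0, the bad pairs of row a are the places where disp f changes
    under translation by a, and every level set has such a place. *)
Lemma image_le_row f a w w' : a != 0 -> disp f a = 0 ->
  w \in disp f @: setT -> w' \in disp f @: setT -> w != w' ->
  (#|disp f @: setT| <= row_defect f a)%N.
Proof.
move=> a0 sa0 Vw Vw' ww'; rewrite row_defectE; set B := [set b | _].
apply: leq_trans (leq_imset_card (disp f) B).
apply/subset_leq_card/subsetP=> u Vu.
have [x _ ux] := imsetP Vu.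
have [||b] := @exit_exists (level f u) _ a0.
- by apply/set0Pn; exists x; rewrite inE ux.
- apply: contra ww' => /eqP/setP lvT.
  have all_u v : v \in disp f @: setT -> v = u.
    by case/imsetP=> t _ ->; have := lvT t; rewrite !inE => /eqP.
  by rewrite (all_u w) // (all_u w').
rewrite !inE => /eqP sb sab; apply/imsetP; exists b => //.
by rewrite inE sa0 add0r sb.
Qed.

(** The displacements of a permutation sum to 0.  Two values, one of which is 0,
    would make the size of the other level set a multiple of p. *)
Lemma image_ge3 f : injective f -> f 1 = 1 -> (exists x, f x != x) ->
  (2 < #|disp f @: setT|)%N.
Proof.
move=> f_inj f1 [x0 fx0]; rewrite ltnNge; apply/negP=> V2.
have V0 : 0 \in disp f @: setT by apply/imsetP; exists 1; rewrite // /disp f1 subrr.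
set g := disp f x0; have g0 : g != 0 by rewrite subr_eq0.
have Vg : g \in disp f @: setT by apply/imsetP; exists x0.
have VE : disp f @: setT = [set 0; g].
  apply/esym/eqP; rewrite eqEcard; apply/andP; split.
    by apply/subsetP=> u; rewrite !inE => /orP[]/eqP->.
  by rewrite cards2 eq_sym g0.
have : \sum_x disp f x = 0.
  by rewrite sumrB [X in _ - X](reindex_inj f_inj) subrr.
have -> : \sum_x disp f x = g *+ #|level f g|.
  rewrite -sumr_const [RHS]big_mkcond; apply: eq_bigr => x _; rewrite inE.
  have : disp f x \in [set 0; g] by rewrite -VE; apply/imsetP; exists x.
  by rewrite !inE => /orP[]/eqP->; rewrite ?eqxx // eq_sym (negPf g0).
move/eqP; rewrite -mulr_natr mulf_eq0 (negPf g0) /=.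
have pch := pchar_Fp p_pr; rewrite -(dvdn_pcharf pch) => pdvd.
have lv_gt0 : (0 < #|level f g|)%N by apply/card_gt0P; exists x0; rewrite inE.
have : (#|level f g| < p)%N.
  rewrite -[X in (_ < X)%N](card_Fp p_pr) -cardsT; apply: proper_card.
  rewrite properT; apply/eqP => /setP/(_ 1); rewrite !inE /disp f1 subrr => /esym.
  by rewrite eq_sym (negPf g0).
by rewrite ltnNge dvdn_leq.
Qed.

(** If c avoids the three sets of bad positions, then f (a + b) + f c and
    f a + f b + f c are both f (a + b + c). *)
Lemma assoc_rows f a b : f (a + b) != f a + f b ->
  (p <= row_defect f a + row_defect f b + row_defect f (a + b)%R)%N.
Proof.
move=> bad; rewrite -[X in (X <= _)%N](card_Fp p_pr) -cardsT.
rewrite {1}/row_defect -[X in (_ <= X + _ + _)%N](card_preimset _ (addrI b)).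
apply: leq_trans _ (leq_add (leq_card_setU _ _) (leqnn _)).
apply: leq_trans _ (leq_card_setU _ _).
apply/subset_leq_card/subsetP=> c _; rewrite !inE.
apply: contraR bad; rewrite !negb_or !negbK => /andP[/andP[/eqP a_bc /eqP bc] /eqP abc].
by rewrite -(inj_eq (addIr (f c))) -abc -addrA a_bc bc addrA.
Qed.

Lemma defect_ge_on f (m : nat) A :
  (forall a, a != 0 -> (m <= row_defect f a)%N) ->
  (\sum_(a in A) row_defect f a + m * (p.-1 - #|A|) <= defect f)%N.
Proof.
move=> m_min; rewrite /defect [X in (_ <= X)%N](bigID (mem A)) /= leq_add2l.
apply: (@leq_trans (\sum_(a in ~: A :\ 0%R) m)%N).
  rewrite sum_nat_const mulnC leq_mul2r; apply/orP; right.
  by rewrite leq_subLR card_compl0.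
rewrite [X in (_ <= X)%N](bigID (fun a => a == 0)) /=; apply: leq_trans (leq_addl _ _).
rewrite (eq_bigl (fun a => (a \notin A) && (a != 0))) => [|a]; last by rewrite !inE andbC.
by apply: leq_sum => a /andP[_ /m_min].
Qed.

Lemma level_card f : (\sum_(w in disp f @: setT) #|level f w| = p)%N.
Proof.
rewrite -[RHS](card_Fp p_pr) -cardsT -sum1_card [RHS](partition_big_imset (disp f)) /=.
apply: eq_bigr => w _; rewrite -sum1_card; apply: eq_bigl => x; by rewrite !inE.
Qed.

(** * Maps normalised by a lightest row *)

Section Normalised.
Variable f : F -> F.
Hypotheses (f_inj : injective f) (f1 : f 1 = 1) (f_neq : exists x, f x != x).
Let m := row_defect f 1.
Hypothesis m_min : forall a, a != 0 -> (m <= row_defect f a)%N.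

Let k := #|level f 0|.
Let v := #|disp f @: setT|.

Lemma disp1 : disp f 1 = 0. Proof. by rewrite /disp f1 subrr. Qed.

Lemma image_le_min : (v <= m)%N.
Proof.
have /card_gt1P[w [w' [Vw Vw' ww']]] : (1 < v)%N by apply: ltnW; apply: image_ge3.
by apply: image_le_row Vw Vw' ww'; rewrite ?oner_eq0 ?disp1.
Qed.

Lemma min_ge3 : (2 < m)%N.
Proof. exact: leq_trans (image_ge3 _ _ _) image_le_min. Qed.

Lemma large_level : exists w, (p <= v * #|level f w| /\ forall u, #|level f u| <= #|level f w|)%N.
Proof.
have [w w_max] : exists w, forall u, (#|level f u| <= #|level f w|)%N.
  by exists [arg max_(w > 0%R) #|level f w|]; case: arg_maxnP => // w _ w_max u; apply: w_max.
exists w; split=> //; apply: leq_trans (_ : \sum_(u in disp f @: setT) #|level f u| <= _)%N.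
  by rewrite level_card.
rewrite -sum_nat_const; by apply: leq_sum => u _.
Qed.

Lemma off_level_ge w a : (m < p)%N -> disp f a != 0 -> (#|level f w| <= row_defect f a)%N.
Proof.
move=> mp; have [y Vy] : exists y, y \notin disp f @: setT.
  apply/existsP; rewrite -[[exists _, _]]negbK negb_exists; apply/negP => /forallP full.
  move: mp; rewrite ltnNge => /negP[]; apply: leq_trans image_le_min.
  by rewrite -(card_Fp p_pr); apply/subset_leq_card/subsetP=> y _; have := full y; rewrite negbK.
apply: (@level_le_row _ _ _ y) => x; apply: contra Vy => /eqP <-.
by apply/imsetP; exists x.
Qed.

Lemma defect_ge_level w : (m < p)%N ->
  (m * k.-1 + #|level f w| * (p - k) <= defect f)%N.
Proof.
move=> mp; rewrite /defect (bigID (fun a => a \in level f 0)) /=; apply: leq_add.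
  apply: (@leq_trans (\sum_(a in level f 0%R :\ 0%R) m)%N).
    rewrite sum_nat_const mulnC leq_mul2r; apply/orP; right.
    exact: card_pred0.
  rewrite [X in (_ <= X)%N](bigID (fun a => a == 0)) /=; apply: leq_trans (leq_addl _ _).
  rewrite (eq_bigl (fun a => (a \in level f 0) && (a != 0))) => [|a]; last by rewrite !inE andbC.
  by apply: leq_sum => a /andP[_ /m_min].
rewrite mulnC; have -> : (p - k = #|~: level f 0%R|)%N.
  by have := card_compl (level f 0); rewrite /k; lia.
rewrite -sum_nat_const [X in (X <= _)%N](eq_bigl (fun a => a \notin level f 0)) => [|a]; last by rewrite inE.
by apply: leq_sum => a; rewrite inE; apply: off_level_ge.
Qed.

(** The m bad pairs (1, b) of row 1 give d b + d (1 + b) >= p - m.  An element can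
    occur both as some b and as some 1 + b, so two copies of the defect are
    needed to add these inequalities up. *)
Lemma defect_ge_assoc : (m <= p -> m * (3 * p - 3 * m - 2) <= 2 * defect f)%N.
Proof.
set C := [set b | f (1 + b) != f 1 + f b] => mp.
have CE : #|C| = m by [].
have C'E : #|[set 1 + b | b in C]| = m by rewrite card_imset //; apply: addrI.
have /= lC := defect_ge_on C m_min; have /= lC' := defect_ge_on [set 1 + b | b in C] m_min.
rewrite big_imset /= in lC'; last by move=> x y _ _; apply: addrI.
have : (\sum_(b in C) (p - m) <= \sum_(b in C) row_defect f b + \sum_(b in C) row_defect f (1 + b)%R)%N.
  rewrite -big_split /=; apply: leq_sum => b; rewrite inE => /assoc_rows.
  by rewrite leq_subLR addnA.
rewrite sum_nat_const CE; move: lC lC'; rewrite CE C'E.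
set X := (m * (p.-1 - m))%N; set Y := (m * (p - m))%N.
have -> : (m * (3 * p - 3 * m - 2) = Y + 2 * X)%N.
  by rewrite /X /Y mulnCA -mulnDr; congr muln; have := prime_gt0 p_pr; lia.
have add_up S S' t : (S + X <= t -> S' + X <= t -> Y <= S + S' -> Y + 2 * X <= 2 * t)%N.
  by lia.
exact: add_up.
Qed.

Let C := ~: level f 0.

Lemma off_level_ge2 : (2 <= #|C|)%N.
Proof.
suff : (v <= 1 + #|C|)%N by have := image_ge3 f_inj f1 f_neq; rewrite -/v; lia.
apply: (@leq_trans #|0%R |: disp f @: C|).
  apply/subset_leq_card/subsetP=> _ /imsetP[x _ ->]; rewrite !inE.
  case: eqVneq => //= sx; apply/imsetP; exists x => //.
  by rewrite !inE sx.
rewrite cardsU1 leq_add ?leq_b1 ?leq_imset_card //.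
Qed.

Let meet a := #|C :&: [set b | a + b \in C]|.

Lemma in_shift a b A : (b \in [set b | a + b \in A]) = (a + b \in A).
Proof. by rewrite inE. Qed.

Lemma card_shift a A : #|[set b | a + b \in A]| = #|A|.
Proof. exact: (card_preimset A (addrI a)). Qed.

(** Both sides count the pairs (a, b) with b and a + b in C; the term #|C| on the
    left comes from a = 0. *)
Lemma sum_meet : (#|C| + \sum_(a | a != 0%R) meet a = #|C| * #|C|)%N.
Proof.
have meetE a : meet a = (\sum_(b in C) (a + b \in C)%R)%N.
  rewrite /meet -sum1_card big_mkcond [RHS]big_mkcond; apply: eq_bigr => b _.
  by rewrite in_setI in_shift; case: (b \in C).
have meet0 : meet 0 = #|C|.
  by rewrite /meet; apply: eq_card => b; rewrite in_setI in_shift add0r andbb.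
rewrite -{1}meet0 -[LHS](bigD1 (F := meet) 0%R (P := predT)) //=.
rewrite (eq_bigr _ (fun a _ => meetE a)) exchange_big /=.
rewrite -[RHS]sum_nat_const; apply: eq_bigr => b _.
rewrite -(card_preimset C (addIr b)) -sum1_card [RHS]big_mkcond; apply: eq_bigr => a _.
by rewrite [X in if X then _ else _]inE; case: (a + b \in C).
Qed.

(** Translation by a moves #|C| - meet a points into C and as many out of it, and
    the displacement changes at each of them. *)
Lemma row_defect_meet a : disp f a = 0 -> (2 * (#|C| - meet a) <= row_defect f a)%N.
Proof.
move=> sa; rewrite row_defectE mul2n -addnn; set C' := [set b | a + b \in C].
have -> : (#|C| - meet a = #|C :\: C'|)%N by rewrite cardsD.
have {2}-> : (#|C :\: C'| = #|C' :\: C|)%N.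
  by rewrite !cardsD setIC (card_shift a C).
rewrite -cardsUI.
have -> : (C :\: C') :&: (C' :\: C) = set0.
  by apply/setP=> b; rewrite in_set0 in_setI !in_setD; case: (b \in C); case: (b \in C').
rewrite cards0 addn0; apply/subset_leq_card/subsetP=> b; rewrite !inE sa add0r.
by case/orP=> /andP[]; rewrite negbK => /eqP-> //; rewrite eq_sym.
Qed.

(** Only the rows of X, where C nearly returns to itself, can have fewer than
    four bad pairs.  Since the values of meet at nonzero elements sum to
    #|C| * (#|C| - 1), there are at most #|C| of them, and they still have three
    bad pairs by min_ge3. *)
Lemma defect_near_line : (m < p)%N ->
  (4 * k.-1 + #|C| * k <= defect f + #|C|)%N.
Proof.
move=> mp; have C2 := off_level_ge2.
pose X : {set F} := [set a | (a != 0) && (#|C| <= (meet a).+1)%N].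
have X_small : (#|X| <= #|C|)%N.
  have : (#|X| * #|C|.-1 <= #|C| * #|C|.-1)%N.
    rewrite -sum_nat_const; apply: (@leq_trans (\sum_(a | a != 0%R) meet a)).
      rewrite [X in (_ <= X)%N](bigID (mem X)) /=; apply: leq_trans (leq_addr _ _).
      rewrite [X in (_ <= X)%N](eq_bigl (mem X)) => [|a]; last by rewrite !inE; case: eqP.
      by apply: leq_sum => a; rewrite in_set => /andP[_ hC]; rewrite -ltnS prednK // ltnW.
    have := sum_meet; move: (\sum_(a | _) _)%N => S; nia.
  by rewrite leq_pmul2r //; lia.
rewrite /defect (bigID (fun a => a \in level f 0)) /= addnAC leq_add //.
  apply: (@leq_trans (\sum_(a in level f 0%R :\ 0%R) (row_defect f a + (a \in X)))%N).
    apply: (@leq_trans (\sum_(a in level f 0%R :\ 0%R) 4)%N).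
      rewrite sum_nat_const mulnC leq_mul2r; apply/orP; right; exact: card_pred0.
    apply: leq_sum => a; rewrite !inE => /andP[a0 /eqP sa].
    have := row_defect_meet sa; have := m_min a0; have := min_ge3.
    by rewrite a0 /=; case: leqP; rewrite /m; lia.
  rewrite big_split leq_add //=.
    rewrite [X in (_ <= X)%N](bigID (fun a => a == 0)) /=; apply: leq_trans (leq_addl _ _).
    by rewrite (eq_bigl (fun a => (a \in level f 0) && (a != 0))) // => a; rewrite !inE andbC.
  apply: leq_trans X_small; rewrite -sum1_card big_mkcond [X in (_ <= X)%N]big_mkcond.
  by apply: leq_sum => a _; case: ifP => //; case: (a \in X).
rewrite -sum_nat_const [X in (X <= _)%N](eq_bigl (fun a => a \notin level f 0)) => [|a]; last by rewrite inE.
by apply: leq_sum => a; rewrite inE; apply: off_level_ge.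
Qed.

(** * Soundness of the search *)

Let u i : nat := f i%:R.

Lemma u_lt i : (u i < p)%N.
Proof. by have := ltn_ord (f i%:R); rewrite [X in (_ < X)%N](Fp_cast p_pr). Qed.

Lemma val_Fp_add x y : nat_of_ord (x + y) = ((nat_of_ord x + nat_of_ord y) %% p)%N.
Proof. by rewrite /= [X in (_ %% X)%N](Fp_cast p_pr). Qed.

Lemma row_errors_le (a : nat) s s' :
  (row_errors p (u a) (map u s) (map u (map (addn a) s ++ s'))
    <= \sum_(b <- s) (f (a%:R + b%:R) != f a%:R + f b%:R)%R)%N.
Proof.
elim: s => [|b s IHs] //=.
rewrite big_cons !eqnE; set bad := (f _ != _).
have good : ~~ bad -> ((u b + u a == u (a + b)) || (u b + u a == u (a + b) + p))%N.
  rewrite negbK /u natrD => /eqP ->; rewrite val_Fp_add addnC.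
  have := u_lt a; have := u_lt b; rewrite /u; move: (nat_of_ord _) (nat_of_ord _) => x y xp yp.
  have [lt|ge] := ltnP (x + y) p; first by rewrite modn_small ?eqxx.
  have -> : ((x + y) %% p = x + y - p)%N by rewrite -{1}(subnK ge) modnDr modn_small //; lia.
  by rewrite subnK // eqxx orbT.
case: bad good => /= [_|/(_ isT)/orP[]->]; last by case: ifP.
  by case: ifP => _; [|case: ifP => _]; lia.
by [].
Qed.

Lemma sum_Fp (G : F -> nat) : (\sum_(i <- iota 0 p) G i%:R = \sum_a G a)%N.
Proof.
rewrite (eq_bigr (fun a : F => G (val a)%:R)) => [|a _]; last by rewrite natr_Fp.
by rewrite -(big_mkord xpredT (fun i => G i%:R)) (Fp_cast p_pr) /index_iota subn0.
Qed.

Lemma row_defect_sum a : row_defect f a = (\sum_b (f (a + b)%R != (f a + f b)%R))%N.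
Proof.
by rewrite /row_defect -sum1_card big_mkcond; apply: eq_bigr => b _; rewrite inE; case: ifP.
Qed.

(** The list of p + n values from a on lets each of the n rows be read with
    neither wrap-around nor shift. *)
Lemma errors_reach_sound need (a n : nat) :
  errors_reach p need (map u (iota 0 p)) (map u (iota a n)) (map u (iota a (n + p))) ->
  (need <= \sum_(i <- iota a n) row_defect f i%:R)%N.
Proof.
elim: n need a => [|n IHn] [|need] a // h.
set r := row_errors p (u a) (map u (iota 0 p)) (map u (iota a (n.+1 + p))).
have {h} := IHn (need.+1 - r)%N a.+1 h; rewrite leq_subLR big_cons => /leq_trans; apply.
rewrite leq_add2r row_defect_sum -sum_Fp {}/r.
by rewrite addnC iotaD -{2}[a]addn0 iotaDl; apply: row_errors_le.
Qed.

Lemma far_sound : far p (map u (iota 0 p)) -> (6 * p - 18 <= defect f)%N.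
Proof.
rewrite /defect -sum_Fp; rewrite /far -map_cat => far_u; apply: errors_reach_sound.
rewrite iotaD map_cat add0n.
suff -> : map u (iota p p) = map u (iota 0 p) by rewrite -map_cat.
rewrite -{1}[p]addn0 iotaDl -map_comp; apply: eq_map => i /=.
by rewrite /u natrD pchar_Fp_0 // add0r.
Qed.

(** The values after which f does not continue with the next residue. *)
Let K := [seq val y | y <- enum (f @: [set b | f (1 + b) != f 1 + f b])].

Lemma size_K : size K = m.
Proof. by rewrite size_map -cardE card_imset. Qed.

Lemma K_sub : subseq K (iota 0 p).
Proof.
rewrite -[X in iota 0 X](Fp_cast p_pr) -val_enum_ord; apply: map_subseq.
by rewrite {1}/enum_mem -enumT; apply: filter_subseq.
Qed.

Lemma next_val x : next p (val x) = val (1 + x).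
Proof.
have xp : (val x < p)%N by have := ltn_ord x; rewrite [X in (_ < X)%N](Fp_cast p_pr).
rewrite /next eqnE -[val (1 + x)]/(nat_of_ord (1 + x)) val_Fp_add; have -> : nat_of_ord (1 : F) = 1%N.
  by rewrite /= [X in (_ %% X)%N](Fp_cast p_pr) modn_small // prime_gt1.
rewrite add1n; case: eqP => [-> | ne]; first by rewrite modnn.
by rewrite modn_small //; move: xp ne => /=; lia.
Qed.

Lemma in_K x : has (eqn (val (f x))) K = (f (1 + x) != f 1 + f x).
Proof.
have -> : has (eqn (val (f x))) K = (val (f x) \in K).
  by apply/hasP/idP => [[z Kz /eqnP->] | Kx] //; exists (val (f x)) => //; apply/eqnP.
by rewrite mem_map ?mem_enum; [rewrite mem_imset ?inE | apply: val_inj].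
Qed.

(** If f (1 + x) were the successor of a value outside K, that value would be
    taken at x, by injectivity. *)
Lemma cut_next x : f (1 + x) != f 1 + f x -> val (f (1 + x)) \in map (next p) K.
Proof.
move=> cut; have [g gK fK] := injF_bij f_inj.
have fx' : f (1 + x) = f 1 + f (g (f (1 + x) - f 1)) by rewrite fK addrCA subrr addr0.
set x' := g _ in fx'; rewrite fx' f1 -next_val map_f //.
rewrite mem_map; last exact: val_inj.
rewrite mem_enum mem_imset // inE; apply: contra cut => /eqP fx'1.
by move: fx'; rewrite -fx'1 => /f_inj/addrI ->; rewrite fx'1.
Qed.

Lemma u_fresh t : (t <= p)%N -> has (eqn (u t)) (rev (map u (iota 1 t.-1))) = false.
Proof.
move=> tp; apply/negP=> /hasP[z]; rewrite mem_rev => /mapP[i + ->] /eqnP.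
rewrite mem_iota => it /val_inj/f_inj/(congr1 val).
have nat_mod (j : nat) : val (j%:R : F) = (j %% p)%N by exact: (val_Fp_nat p_pr).
rewrite !nat_mod (@modn_small i); last by lia.
by case: (ltnP t p) => [lt|ge]; [rewrite modn_small | rewrite (_ : t = p) ?modnn]; lia.
Qed.

Lemma search_sound n t : (0 < t)%N -> (n + t = p)%N ->
  search p K n (rev (map u (iota 1 t))) -> far p (map u (iota 0 p)).
Proof.
have split_last i : rev (map u (iota 1 i.+1)) = u i.+1 :: rev (map u (iota 1 i)).
  by rewrite -[X in iota 1 X]addn1 iotaD map_cat rev_cat /= add1n.
elim: n t => [|n IHn] [|t] // _; rewrite split_last /=.
  rewrite add0n revK => tp; suff -> : map u (iota 0 p) = u t.+1 :: map u (iota 1 t) by [].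
  by rewrite -[X in iota 0 X]tp /= /u tp pchar_Fp_0.
rewrite addSnnS => tp; have fS : f (t.+2)%:R = f (1 + (t.+1)%:R) by rewrite -natr1 addrC.
have := in_K (t.+1)%:R; rewrite /= -/(u t.+1) => ->.
case: ifP => [cut /allP/(_ (u t.+2)) | /negbFE/eqP cut].
  rewrite {1}/u fS cut_next // => /(_ isT).
  have -> : eqn (u t.+2) (next p (u t.+1)) = false.
    apply/negP=> /eqnP; rewrite /u next_val fS => /val_inj eq_next.
    by case/eqP: cut; rewrite eq_next f1.
  have fresh : has (eqn (u t.+2)) (u t.+1 :: rev (map u (iota 1 t))) = false.
    by rewrite -split_last u_fresh; lia.
  by move: fresh => /= ->; rewrite -!split_last; apply: IHn.
have -> : next p (u t.+1) = u t.+2 by rewrite /u next_val fS cut f1.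
by rewrite -!split_last; apply: IHn.
Qed.

Lemma certified_sound : certified p m -> (6 * p - 18 <= defect f)%N.
Proof.
move/allP/(_ K); rewrite -size_K (mem_sublists K_sub) => /(_ isT) srch.
apply/far_sound/(@search_sound p.-1 1) => //; first by have := prime_gt0 p_pr; lia.
by rewrite /= /u f1.
Qed.

(** * The lower bound *)

Lemma defect_ge_normalised : (7 < p)%N -> (6 * p - 18 <= defect f)%N.
Proof.
move=> p7; have m3 := min_ge3.
have [m6|m6] := leqP 6 m.
  have := defect_ge_on set0 m_min; rewrite big_set0 cards0 add0n subn0.
  by apply: leq_trans; have := leq_mul m6 (leqnn p.-1); lia.
have [small|not_small] := boolP ((p, m) \in small_cases).
  exact/certified_sound/(allP small_cases_certified _ small).
have p_ge : (m = 5 /\ 16 < p \/ m = 3 /\ 18 < p \/ m = 4 /\ 22 < p)%N.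
  have m345 : m \in [:: 3; 4; 5]%N by rewrite !inE; lia.
  have [p23|p22] := leqP 23 p; first by move: m345; rewrite !inE; lia.
  have p_range : p \in iota 8 15 by rewrite mem_iota p7.
  have small_primes : all (fun n => all (fun q => [==> prime n, (n, q) \notin small_cases
      => (q == 5) && (16 < n) || (q == 3) && (18 < n)]%N) [:: 3; 4; 5]%N) (iota 8 15).
    by [].
  have := allP (allP small_primes p p_range) m m345; rewrite p_pr not_small /=.
  by case/orP=> /andP[/eqP-> ?]; [left | right; left].
have mp : (m < p)%N by lia.
case: p_ge => [[m5 p16]|p_ge].
  by have := defect_ge_assoc (ltnW mp); rewrite m5; lia.
have [w [pM M_max]] := large_level.
apply: (@counting_ge p m #|level f w| k #|C|) => //.
- by apply: leq_trans pM _; rewrite leq_mul2r image_le_min orbT.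
- exact: M_max.
- have [-> |w0] := eqVneq w 0; [by left | right].
  have kC : (k + #|C| = p)%N by apply: card_compl.
  rewrite -[X in (_ <= X)%N]kC leq_add2l subset_leq_card //; apply/subsetP=> x.
  by rewrite !inE => /eqP->.
- exact: card_compl.
- exact: off_level_ge2.
- exact: defect_ge_level.
exact: defect_near_line.
Qed.

End Normalised.

(** Multiplying the argument by a0 and dividing the values by f a0 permutes the
    rows and moves the lightest nonzero row a0 to row 1. *)
Lemma defect_ge f : (7 < p)%N -> injective f -> (exists a b, f (a + b) != f a + f b) ->
  (6 * p - 18 <= defect f)%N.
Proof.
move=> p7 f_inj [a1 [b1 ab1]].
have [a0 a0_neq0 a0_min] : exists2 a0 : F, a0 != 0 &
    forall a, a != 0 -> (row_defect f a0 <= row_defect f a)%N.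
  exists [arg min_(a < (1 : F) | a != 0) row_defect f a]; case: arg_minnP => //; exact: oner_neq0.
have [row6|row6] := leqP 6 (row_defect f a0).
  have := defect_ge_on set0 a0_min; rewrite big_set0 cards0 add0n subn0.
  by apply: leq_trans; have := leq_mul row6 (leqnn p.-1); lia.
have fa0 : f a0 != 0.
  apply/negP=> /eqP fa0; move: row6; rewrite /row_defect.
  have -> : [set b | f (a0 + b) != f a0 + f b] = setT.
    apply/setP=> b; rewrite !inE fa0 add0r (inj_eq f_inj) -subr_eq0 addrK //.
  by rewrite cardsT card_Fp //; lia.
pose g (x : F) : F := f (a0 * x) / f a0.
have g_inj : injective g by move=> x y /(mulIf (invr_neq0 fa0))/f_inj/(mulfI a0_neq0).
have g1 : g 1 = 1 by rewrite /g mulr1 divff.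
have rowE a : row_defect g a = row_defect f (a0 * a).
  rewrite /row_defect -[RHS](card_preimset _ (mulfI a0_neq0)).
  apply: eq_card => b; rewrite !inE /g mulrDr -mulrDl.
  by rewrite (inj_eq (mulIf (invr_neq0 fa0))).
have <- : defect g = defect f.
  by rewrite /defect [RHS](reindex_inj (mulfI a0_neq0)); apply: eq_bigr.
have g_min (a : F) : a != 0 -> (row_defect g 1%R <= row_defect g a)%N.
  by move=> an0; rewrite !rowE mulr1 a0_min // mulf_neq0.
have g_neq : exists x, g x != x.
  case: (pickP (fun x => g x != x)) => [x gx|idg]; first by exists x.
  have [c fE] : exists c, forall x, f x = x / a0 * c.
    exists (f a0) => x; have /negbFE/eqP := idg (x / a0).
    by rewrite /g [a0 * _]mulrC divfK // => <-; rewrite divfK.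
  by case/eqP: ab1; rewrite !fE -!mulrDl.
exact: defect_ge_normalised.
Qed.

End Defect.

(** * Group laws of prime order *)

Section LawGroup.
Variables (G : finType) (op : G -> G -> G) (e : G) (inv : G -> G).
Hypotheses (opA : associative op) (op1 : left_id e op).
Hypothesis opV : left_inverse e inv op.

(** A copy of G whose name records the group axioms, so that the group structure
    can be attached to it. *)
Definition law_carrier : Type := let _ := (opA, op1, opV) in G.
HB.instance Definition _ := Finite.copy law_carrier G.
HB.instance Definition _ := Finite_isGroup.Build law_carrier opA op1 opV.

Lemma law_prime_cyclic p : prime p -> #|G| = p ->
  exists psi : 'F_p -> G, bijective psi /\ {morph psi : i j / i + j >-> op i j}.
Proof.
move=> p_pr cardG.
have cG : #|[set: law_carrier]| = p.
  by rewrite cardsT -cardG; apply: (@bij_eq_card _ _ (id : law_carrier -> G)); exists id.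
have /cyclicP[x Gx] : cyclic [set: law_carrier] by rewrite prime_cyclic // cG.
have ox : #[x]%g = p by rewrite orderE -Gx.
pose psi (i : 'F_p) : law_carrier := (x ^+ i)%g.
exists psi; split.
  apply: inj_card_bij; last by rewrite card_Fp // cardG.
  move=> i j psi_ij; have /eqP : (x ^+ i)%g = (x ^+ j)%g :> law_carrier by exact: psi_ij.
  rewrite eq_expg_mod_order ox.
  have lt_p (k : 'F_p) : (k < p)%N by have := ltn_ord k; rewrite [X in (_ < X)%N]Fp_cast.
  by rewrite !modn_small // => /eqP/val_inj.
move=> i j; have : psi (i + j) = (psi i * psi j)%g.
  apply/eqP; rewrite /psi -expgD eq_expg_mod_order ox val_Fp_add //.
  by rewrite modn_mod.
by apply.
Qed.
End LawGroup.

Lemma group_law_Fp (G : finType) (op : G -> G -> G) p :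
  group_law op -> prime p -> #|G| = p ->
  exists psi : 'F_p -> G, bijective psi /\ {morph psi : i j / i + j >-> op i j}.
Proof.
by move=> /group_lawP[opA [e [inv [op1 _ opV _]]]]; apply: law_prime_cyclic opA op1 opV _.
Qed.

Lemma morph_group_law (p : nat) (G : finType) (op : G -> G -> G) (psi : 'F_p -> G) :
  bijective psi -> {morph psi : i j / i + j >-> op i j} -> group_law op.
Proof.
move=> [phi psiK phiK] psiD; have opE x y : op x y = psi (phi x + phi y) by rewrite psiD !phiK.
apply/group_lawP; split; first by move=> x y z; rewrite !opE !psiK addrA.
exists (psi 0), (fun x => psi (- phi x)); split=> x;
  by rewrite opE !psiK ?add0r ?addr0 ?addNr ?addrN ?phiK.
Qed.

Lemma dist_defect (p : nat) (G : finType) (op ast : G -> G -> G)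
  (psi psi' : 'F_p -> G) (f : 'F_p -> 'F_p) :
  bijective psi -> {morph psi : i j / i + j >-> op i j} ->
  injective psi' -> {morph psi' : i j / i + j >-> ast i j} ->
  (forall i, psi i = psi' (f i)) ->
  cayley_dist op ast = defect f.
Proof.
move=> psi_bij psiD psi'_inj psi'D fE.
have psi_inj := bij_inj psi_bij; have [phi psiK phiK] := psi_bij.
rewrite /cayley_dist /defect /row_defect.
under [RHS]eq_bigr do rewrite -sum1dep_card.
rewrite pair_big_dep /= sum1dep_card -(card_imset _ (_ : injective (fun ij => (psi ij.1, psi ij.2)))).
  apply: eq_card => -[a b]; rewrite inE /=; apply/idP/imsetP => [ab | [[i j] + [-> ->]]].
    exists (phi a, phi b); last by rewrite /= !phiK.
    move: ab; rewrite inE /= -{1}(phiK a) -{1}(phiK b) -psiD fE.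
    by rewrite -{2}(phiK a) -{2}(phiK b) !fE -psi'D (inj_eq psi'_inj).
  by rewrite inE /= -psiD !fE -psi'D (inj_eq psi'_inj).
by move=> [i j] [i' j'] [/psi_inj-> /psi_inj->].
Qed.

(** * The swap of 1 and -1 *)

Section Transposition.
Variable p : nat.
Hypotheses (p_pr : prime p) (p4 : (4 < p)%N).
Local Notation F := 'F_p.
Local Notation swap := (tperm (1 : F) (-1)).

Lemma nat_Fp_neq (x y : F) n : (0 < n < p)%N -> x - y = n%:R -> x != y.
Proof.
move=> n_lt xy; rewrite -subr_eq0 xy -(dvdn_pcharf (pchar_Fp p_pr)).
by apply/negP=> /dvdn_leq; lia.
Qed.

Lemma swapD x : x != 1 -> x != -1 -> swap x = x.
Proof. by move=> x1 xN1; rewrite tpermD // eq_sym. Qed.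

Lemma swap0 : swap 0 = 0.
Proof. by rewrite swapD // eq_sym ?oppr_eq0 oner_eq0. Qed.

(** A pair (a, b) in such a row is bad only if b or a + b is 1 or -1. *)
Lemma swap_row_generic a : a != 1 -> a != -1 ->
  (row_defect swap a <= size (undup [:: 1; -1; 1 - a; -1 - a]%R))%N.
Proof.
move=> a1 aN1; rewrite -(card_uniqP (undup_uniq _)).
apply/subset_leq_card/subsetP=> b; rewrite !inE mem_undup !inE; apply: contraR.
rewrite !negb_or => /and4P[b1 bN1 ab1 abN1]; rewrite !swapD //.
  by apply: contra ab1 => /eqP<-; apply/eqP; ring.
by apply: contra abN1 => /eqP<-; apply/eqP; ring.
Qed.

Lemma swap_row_0 : row_defect swap 0 = 0%N.
Proof. by apply: eq_card0 => b; rewrite inE swap0 !add0r eqxx. Qed.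

(** The pairs of a with 0 and with - a are good. *)
Lemma swap_row_swapped a : a \in [:: 1; -1] -> (row_defect swap a <= p - 2)%N.
Proof.
move=> a_sw; have a0 : a != 0 by move: a_sw; rewrite !inE => /orP[]/eqP->; rewrite ?oppr_eq0 oner_eq0.
have <- : #|~: [set 0; - a]| = (p - 2)%N.
  have := card_compl p_pr [set 0; - a]; rewrite cards2 [0 == _]eq_sym oppr_eq0 a0.
  by move=> /(congr1 (subn^~ 2%N)); rewrite /= addKn.
apply/subset_leq_card/subsetP=> b; rewrite !inE; apply: contraL => /orP[]/eqP->.
  by rewrite swap0 !addr0 eqxx.
rewrite subrr swap0 negbK; move: a_sw; rewrite !inE => /orP[]/eqP->.
  by rewrite tpermL tpermR addNr.
by rewrite opprK tpermR tpermL subrr.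
Qed.

(** The rows 1 and -1 contribute p - 2 each, the rows 2 and -2, for which two of the
    four positions of swap_row_generic coincide, contribute 3 each, and the p - 5
    other nonzero rows contribute 4 each. *)
Lemma swap_defect : (defect swap <= 6 * p - 18)%N.
Proof.
pose s : seq F := [:: 0; 1; -1; 2; -2].
have s_uniq : uniq s.
  rewrite /= !inE !negb_or !andbT; do ![apply/andP; split].
  - rewrite eq_sym; apply: (@nat_Fp_neq _ _ 1); [lia | ring].
  - apply: (@nat_Fp_neq _ _ 1); [lia | ring].
  - rewrite eq_sym; apply: (@nat_Fp_neq _ _ 2); [lia | ring].
  - apply: (@nat_Fp_neq _ _ 2); [lia | ring].
  - apply: (@nat_Fp_neq _ _ 2); [lia | ring].
  - rewrite eq_sym; apply: (@nat_Fp_neq _ _ 1); [lia | ring].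
  - apply: (@nat_Fp_neq _ _ 3); [lia | ring].
  - rewrite eq_sym; apply: (@nat_Fp_neq _ _ 3); [lia | ring].
  - apply: (@nat_Fp_neq _ _ 1); [lia | ring].
  - apply: (@nat_Fp_neq _ _ 4); [lia | ring].
have two1 : (2 : F) != 1 by apply: (@nat_Fp_neq _ _ 1); [lia | ring].
have twoN1 : (2 : F) != -1 by apply: (@nat_Fp_neq _ _ 3); [lia | ring].
rewrite /defect (bigID (mem s)) /= -big_uniq //= !big_cons big_nil swap_row_0.
have row_pm1 : (row_defect swap 1%R <= p - 2)%N by rewrite swap_row_swapped ?inE ?eqxx.
have row_mp1 : (row_defect swap (-1)%R <= p - 2)%N by rewrite swap_row_swapped ?inE ?eqxx ?orbT.
have row_2 : (row_defect swap 2%R <= 3)%N.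
  apply: leq_trans (swap_row_generic two1 twoN1) _.
  rewrite (_ : 1 - 2 = -1 :> F) /=; last by ring.
  by rewrite !inE eqxx /=; do ![case: ifP => _].
have row_m2 : (row_defect swap (-2)%R <= 3)%N.
  apply: leq_trans (swap_row_generic _ _) _.
  - by rewrite -eqr_oppLR in twoN1 *.
  - by rewrite eqr_opp.
  rewrite (_ : -1 - -2 = 1 :> F) /=; last by ring.
  by rewrite !inE eqxx !orbT /=; do ![case: ifP => _].
have rest : (\sum_(a | a \notin s) row_defect swap a <= 4 * (p - 5))%N.
  have -> : (p - 5 = #|[predC s]|)%N.
    have s5 : #|mem s| = 5%N by apply/card_uniqP.
    have := cardC (mem s); rewrite s5 card_Fp // => /(congr1 (subn^~ 5%N)).
    by rewrite addKn => <-.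
  rewrite mulnC -sum_nat_const; apply: leq_sum => a; rewrite !inE !negb_or => /and5P[a0 a1 aN1 _ _].
  by apply: leq_trans (swap_row_generic a1 aN1) (size_undup _).
apply: leq_trans (leq_add (leq_add (leqnn _) (leq_add row_pm1 (leq_add row_mp1
  (leq_add row_2 (leq_add row_m2 (leqnn _)))))) rest) _.
by lia.
Qed.

Lemma swap_not_additive : exists a b, swap (a + b) != swap a + swap b.
Proof.
exists 1, 1; rewrite tpermL swapD.
- by apply: (@nat_Fp_neq _ _ 4); [lia | ring].
- by apply: (@nat_Fp_neq _ _ 1); [lia | ring].
by apply: (@nat_Fp_neq _ _ 3); [lia | ring].
Qed.

End Transposition.

(** * The Cayley stability *)

Local Close Scope ring_scope.

Theorem theorem6p1 (p : nat) (hp : prime p) (hp7 : 7 < p)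
    (G : finType) (hG : #|G| = p)
    (op : G -> G -> G) (hop : group_law op) :
  cayley_stability op = 6 * p - 18.
Proof.
have [psi [psi_bij psiD]] := group_law_Fp hop hp hG.
have psi_inj := bij_inj psi_bij.
have lower ast : group_law ast -> ~ ast =2 op -> 6 * p - 18 <= cayley_dist op ast.
  move=> ast_law ast_op; have [psi' [[phi' psiK' phiK'] psiD']] := group_law_Fp ast_law hp hG.
  pose f i := phi' (psi i).
  have fE i : psi i = psi' (f i) by rewrite /f phiK'.
  rewrite (dist_defect psi_bij psiD (can_inj psiK') psiD' fE); apply: defect_ge => //.
    by move=> i j /(can_inj phiK')/psi_inj.
  case: (pickP (fun ij => f (ij.1 + ij.2)%R != (f ij.1 + f ij.2)%R)) => [[i j] bad | good].
    by exists i, j.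
  case: ast_op => x y; have [phi psiK phiK] := psi_bij.
  rewrite -(phiK x) -(phiK y) -psiD !fE -psiD'; congr psi'.
  by have /negbFE/eqP := good (phi x, phi y).
have p4 : 4 < p by lia.
(* The witness is the addition of 'F_p read through psi \o swap. *)
pose swap := tperm (1%R : 'F_p) (-1)%R.
pose psi' i := psi (swap i).
have psi'_bij : bijective psi' by apply: bij_comp psi_bij (injF_bij (@perm_inj _ swap)).
have [phi' psiK' phiK'] := psi'_bij.
pose ast x y := psi' (phi' x + phi' y)%R.
have psiD' : {morph psi' : i j / (i + j)%R >-> ast i j} by move=> i j; rewrite /ast !psiK'.
have swapE i : psi i = psi' (swap i) by rewrite /psi' tpermK.
have distE := dist_defect psi_bij psiD (can_inj psiK') psiD' swapE.
have ast_law : group_law ast := morph_group_law psi'_bij psiD'.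
have ast_op : ~ ast =2 op.
  move=> ast_op; have := defect_ge hp hp7 (@perm_inj _ swap) (swap_not_additive hp p4).
  by rewrite -distE /cayley_dist eq_card0 => [|[x y]]; [lia | rewrite inE ast_op eqxx].
apply/cayley_stabilityP; [by exists ast | split=> //].
exists ast; split=> //; apply/eqP; rewrite eqn_leq lower // andbT distE.
exact: swap_defect.
Qed.
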